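(* Let $B,b>0$. There exist real constants $C,c>0$, depending only on $B$ and $b$ (in particular not on $n$), such that the following holds for every integer $n\ge 1$. Let $M$ be a random real $n\times n$ matrix with rows $R_1,\dots,R_n$. Assume that the rows $R_1,\dots,R_n$ are independent and that they are uniformly sub-Gaussian in norm with constants $B,b$, i.e. $\mathbb{P}(\|R_i\|>t)\le B\exp(-bt^2)$ for all $t>0$ and all $i=1,\dots,n$. Then $$\mathbb{P}\left(\|M\|_{op}>A\sqrt n\right)\le C\exp(-cAn)\qquad\text{for all } A\ge C.$$ In particular, $\|M\|_{op}=O(\sqrt n)$ with overwhelming probability.
   Context: $\|\cdot\|$ denotes the Euclidean norm on $\mathbb{R}^n$, and for a real $n\times n$ matrix $X$, $\|X\|_{op}=\sup\{\|Xu\| : u\in\mathbb{R}^n,\ \|u\|\le 1\}$. The coefficients within a single row are not assumed independent. An event $E$ (depending on $n$) holds with overwhelming probability if for every fixed real $k>0$ there is a constant $C_k$ independent of $n$ with $\mathbb{P}(E)\ge 1-C_k/n^k$. The assertion ''$\|M\|_{op}=O(\sqrt n)$ with overwhelming probability'' means that there is a constant $K$ independent of $n$ (depending only on $B,b$) such that the event $\{\|M\|_{op}\le K\sqrt n\}$ holds with overwhelming probability, with $C_k$ depending only on $k,B,b$. *)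

(* Defs.v *)
From HB Require Import structures.
From mathcomp Require Import all_boot all_order all_algebra.
From mathcomp Require Import all_classical all_reals all_analysis.

Set Implicit Arguments.
Unset Strict Implicit.
Unset Printing Implicit Defensive.

Import Order.TTheory GRing.Theory Num.Theory.
Import numFieldNormedType.Exports.

Local Open Scope classical_set_scope.
Local Open Scope ring_scope.

(* The topological space V equipped with its Borel sigma-algebra. *)
Notation borel V := (g_sigma_algebraType (@open V)).

(* R^n is 'cV[R]_n; the library norm `|u| on matrices is the sup norm, hence
   this separate Euclidean norm. *)
Definition enorm (R : realType) (n : nat) (u : 'cV[R]_n) : R :=
  Num.sqrt (\sum_(i < n) u i ord0 ^+ 2).

Definition opnorm (R : realType) (n : nat) (X : 'M[R]_n) : R :=
  sup [set enorm (X *m u) | u in [set u : 'cV[R]_n | enorm u <= 1]].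

Definition rowvec (R : realType) (n : nat) (i : 'I_n) (X : 'M[R]_n) : 'cV[R]_n :=
  (row i X)^T.

(* Mutual independence of a finite family of V-valued random elements. *)
Definition mutually_independent (R : realType) (d : measure_display)
    (T : measurableType d) (P : probability T R) (I : finType)
    (V : ptopologicalType) (X : I -> T -> V) : Prop :=
  forall (J : {set I}) (A : I -> set V),
    (forall i, i \in J -> measurable (A i : set (borel V))) ->
    P (\bigcap_(i in [set` J]) X i @^-1` A i) =
    (\prod_(i in J) P (X i @^-1` A i))%E.

Definition subgaussian_in_norm (R : realType) (d : measure_display)
    (T : measurableType d) (P : probability T R) (n : nat)
    (X : T -> 'cV[R]_n) (B b : R) : Prop :=
  forall t : R, 0 < t ->
    (P [set w | (t < enorm (X w))%R] <= (B * expR (- b * t ^+ 2))%:E)%E.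

Definition indep_subgaussian_rows (R : realType) (B b : R)
    (d : measure_display) (T : measurableType d) (P : probability T R)
    (n : nat) (M : {RV P >-> borel 'M[R]_n}) : Prop :=
  mutually_independent P (fun (i : 'I_n) (w : T) => rowvec i (M w)) /\
  forall i : 'I_n, subgaussian_in_norm P (fun w : T => rowvec i (M w)) B b.

(* Main.v *)
(* The operator norm is at most the Frobenius norm, so only the sum of the
   squared row norms matters. Put h = 2 / b. If that sum exceeds h (m + n), then
   rounding each |R_i|^2 / h down to an integer capped at m gives a vector k of
   integers in [0, m] with sum at least m and |R_i|^2 > h k_i whenever k_i > 0.
   By independence, a given k occurs with probability at most
   (1 + B)^n exp(-2 sum k_i); summing over all admissible k, with half of the
   exponent spent on the convergence of the sum, leaves
   exp(-m) (2 (1 + B))^n. Take m = n floor(A). *)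
Require Import Defs.
From HB Require Import structures.
From mathcomp Require Import all_boot all_order all_algebra.
From mathcomp Require Import all_classical all_reals all_analysis.
From mathcomp Require Import ring lra.

Set Implicit Arguments.
Unset Strict Implicit.
Unset Printing Implicit Defensive.

Import Order.TTheory GRing.Theory Num.Theory.
Import numFieldNormedType.Exports.

Local Open Scope classical_set_scope.
Local Open Scope ring_scope.

(** * Euclidean, Frobenius and operator norms *)

Section Norms.
Variable R : realType.

Lemma enorm_ge0 n (u : 'cV[R]_n) : 0 <= enorm u.
Proof. exact: sqrtr_ge0. Qed.

Lemma enorm_sqr n (u : 'cV[R]_n) : enorm u ^+ 2 = \sum_i u i ord0 ^+ 2.
Proof. by rewrite sqr_sqrtr // sumr_ge0 // => i _; exact: sqr_ge0. Qed.

Lemma enorm0 n : enorm (0 : 'cV[R]_n) = 0.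
Proof.
by rewrite /enorm big1 ?sqrtr0 // => i _; rewrite mxE expr0n.
Qed.

Lemma continuous_enorm (V : topologicalType) n (f : V -> 'cV[R]_n) :
  (forall i, continuous (fun X => f X i ord0)) -> continuous (fun X => enorm (f X)).
Proof.
move=> fc X; rewrite /enorm.
apply: (@continuous_comp _ _ _ (fun X => \sum_(i < n) f X i ord0 ^+ 2) Num.sqrt);
  last exact: sqrt_continuous.
apply: continuous_big => [|i _ Y]; first exact: add_continuous.
by apply: continuousM; exact: fc.
Qed.

(** Cauchy-Schwarz: expand the nonnegative sum of [(a j - p * u j) ^+ 2], where [p] is the dot
    product itself. *)
Lemma sqr_dotprod_le n (a u : 'I_n -> R) : \sum_j u j ^+ 2 <= 1 ->
  (\sum_j a j * u j) ^+ 2 <= \sum_j a j ^+ 2.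
Proof.
move=> u1; set p := \sum_j a j * u j.
have : 0 <= \sum_j (a j - p * u j) ^+ 2 by apply: sumr_ge0 => j _; exact: sqr_ge0.
have expand (q : R) : \sum_j (a j - q * u j) ^+ 2 =
    \sum_j a j ^+ 2 - 2 * q * \sum_j a j * u j + q ^+ 2 * \sum_j u j ^+ 2.
  rewrite !mulr_sumr -sumrB -big_split /=.
  by apply: eq_bigr => j _; ring.
rewrite expand -/p.
have : p ^+ 2 * \sum_j u j ^+ 2 <= p ^+ 2 by rewrite ler_piMr // sqr_ge0.
lra.
Qed.

Lemma enorm_mulmx_le n (X : 'M[R]_n) (u : 'cV[R]_n) : enorm u <= 1 ->
  enorm (X *m u) ^+ 2 <= \sum_i enorm (rowvec i X) ^+ 2.
Proof.
move=> u1; rewrite enorm_sqr; apply: ler_sum => i _.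
rewrite enorm_sqr mxE; under [leRHS]eq_bigr do rewrite !mxE.
apply: sqr_dotprod_le.
by rewrite -enorm_sqr -(expr1n _ 2) lerXn2r ?nnegrE ?enorm_ge0 ?ler01.
Qed.

(** The supremum is a genuine one: its set contains the value at [u = 0] and is bounded by the
    Frobenius norm. *)
Lemma lt_opnormP n (X : 'M[R]_n) (a : R) :
  a < opnorm X <-> exists2 u : 'cV[R]_n, enorm u <= 1 & a < enorm (X *m u).
Proof.
split=> [/sup_gt[|_ [u u1 <-] au]|[u u1 au]]; last 2 first.
- by exists u.
- apply: (lt_le_trans au); apply: ub_le_sup; last by exists u.
  exists (Num.sqrt (\sum_i enorm (rowvec i X) ^+ 2)) => _ [v v1 <-].
  rewrite -(ger0_norm (enorm_ge0 _)) -sqrtr_sqr ler_wsqrtr //.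
  exact: enorm_mulmx_le.
- by exists (enorm (X *m 0)); exists 0 => //=; rewrite enorm0 ler01.
Qed.

(** The set is a union over the uncountable unit ball, so Borel measurability is reached through
    openness, which survives arbitrary unions. *)
Lemma open_lt_opnorm n (a : R) : open [set X : 'M[R]_n | a < opnorm X].
Proof.
have -> : [set X : 'M[R]_n | a < opnorm X] =
    \bigcup_(u in [set u : 'cV[R]_n | enorm u <= 1])
      (fun X : 'M[R]_n => enorm (X *m u)) @^-1` [set y | a < y].
  apply/seteqP; split=> X /=.
    by move=> /lt_opnormP[u u1 au]; exists u.
  by move=> [u u1 au]; apply/lt_opnormP; exists u.
apply: bigcup_open => u _; apply: open_comp; last exact: open_gt.
move=> X _; apply: continuous_enorm => i; rewrite [X in continuous X](_ : _ =
    (fun X : 'M[R]_n => \sum_j X i j * u j ord0)); last first.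
  by apply/funext => Y; rewrite mxE.
apply: continuous_big => [|j _ Y]; first exact: add_continuous.
by apply: continuousM; [exact: coord_continuous|exact: cst_continuous].
Qed.

Lemma measurable_borel (V : ptopologicalType) (U : set V) :
  open U -> measurable (U : set (borel V)).
Proof. exact: sub_sigma_algebra. Qed.

End Norms.

(** * Rounding to integer vectors and counting them *)

Section Discretization.
Variable R : realType.

(** Take each [k i] as large as allowed. If they summed to less than [m], none would reach the cap,
    so [r i <= h * (k i + 1)] for all [i]; the [n] in [m + n] absorbs these rounding errors and
    gives a contradiction. *)
Lemma large_sum_witness n m (h : R) (r : 'I_n -> R) : 0 < h ->
  h * (m + n)%:R < \sum_i r i ->
  exists2 k : {ffun 'I_n -> 'I_m.+1}, (m <= \sum_i k i)%N &
    forall i, (k i == ord0) || (h * (k i)%:R < r i).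
Proof.
move=> h0 hr; pose Q i (j : 'I_m.+1) := (j == ord0) || (h * j%:R < r i).
pose k := [ffun i => [arg max_(j > ord0 | Q i j) (j : nat)]].
have kP i : Q i (k i) /\ forall j, Q i j -> (j <= k i)%N.
  by rewrite ffunE; case: arg_maxnP => //; rewrite /Q eqxx.
exists k => [|i]; last by have [] := kP i.
rewrite leqNgt; apply/negP => ksum; move: hr; apply/negP; rewrite -leNgt.
have rk i : r i <= h * ((k i).+1)%:R.
  (* Since [k i] is at most the sum, hence below [m], its successor is still a candidate in
     ['I_m.+1]. *)
  have kim : ((k i).+1 < m.+1)%N.
    by rewrite ltnS (leq_trans _ ksum) // ltnS (bigD1 i) //= leq_addr.
  rewrite leNgt; apply/negP => hk.
  have Qk : Q i (Ordinal kim) by rewrite /Q hk orbT.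
  by have [_ /(_ _ Qk)] := kP i; rewrite ltnn.
apply: (le_trans (ler_sum _ (fun i _ => rk i))).
rewrite -mulr_sumr -natr_sum ler_pM2l // ler_nat.
under eq_bigr do rewrite -addn1.
by rewrite big_split /= sum_nat_const card_ord muln1 leq_add2r ltnW.
Qed.

Lemma geometric_sum_le2 m (y : R) : 0 <= y -> y <= 2^-1 -> \sum_(j < m) y ^+ j <= 2.
Proof.
move=> y0 y1; elim: m => [|m IH]; first by rewrite big_ord0.
rewrite big_ord_recl expr0.
under eq_bigr do rewrite lift0 exprS.
rewrite -mulr_sumr.
have : y * \sum_(j < m) y ^+ j <= 2^-1 * 2.
  by rewrite ler_pM // sumr_ge0 // => j _; exact: exprn_ge0.
lra.
Qed.

Lemma weighted_count_le n m (D y : R) : 0 <= D -> 0 <= y -> y <= 2^-1 ->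
  \sum_(k : {ffun 'I_n -> 'I_m.+1} | (m <= \sum_i k i)%N)
    \prod_i (D * y ^+ (2 * k i)) <= y ^+ m * (2 * D) ^+ n.
Proof.
move=> D0 y0 y1.
have t0 (j : nat) : 0 <= D * y ^+ j by rewrite mulr_ge0 // exprn_ge0.
have y_le1 : y <= 1 by lra.
apply: (@le_trans _ _ (\sum_(k : {ffun 'I_n -> 'I_m.+1})
    y ^+ m * \prod_i (D * y ^+ (k i)))).
  rewrite [leLHS]big_mkcond; apply: ler_sum => k _; case: ifPn => [mk|_]; last first.
    by rewrite mulr_ge0 ?exprn_ge0 ?prodr_ge0.
  have -> : \prod_i (D * y ^+ (2 * k i)) = y ^+ (\sum_i k i) * \prod_i (D * y ^+ k i).
    rewrite -prodrXr -big_split /=; apply: eq_bigr => i _.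
    by rewrite mul2n -addnn exprD; ring.
  by rewrite ler_wpM2r ?prodr_ge0 // ler_wiXn2l.
rewrite -mulr_sumr ler_wpM2l ?exprn_ge0 //.
rewrite -(bigA_distr_bigA (fun (_ : 'I_n) (j : 'I_m.+1) => D * y ^+ j)) /=.
rewrite prodr_const card_ord lerXn2r ?nnegrE ?mulr_ge0 ?sumr_ge0 //.
by rewrite -mulr_sumr mulrC ler_wpM2r // geometric_sum_le2.
Qed.

End Discretization.

(** * Union bound over the integer vectors *)

Section Tail.
Variables (R : realType) (d : measure_display) (T : measurableType d).
Variable P : probability T R.

Lemma finite_union_bound (I : finType) (Q : pred I) (F : set T) (E : I -> set T) :
  measurable F -> (forall i, Q i -> measurable (E i)) ->
  (forall w, F w -> exists2 i, Q i & E i w) ->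
  (P F <= \sum_(i | Q i) P (E i))%E.
Proof.
move=> mF mE FE.
rewrite bigfs /=; [|exact: index_enum_uniq|by move=> i _; rewrite mem_index_enum].
apply: content_sub_fsum => // w /FE[i Qi Eiw]; by exists i.
Qed.

(** Stated for any measurable [F] inside the large-sum event, so that it applies directly to the
    operator norm event. *)
Lemma sum_sqr_rows_tail (B b : R) n (M : {RV P >-> borel 'M[R]_n}) m (F : set T) :
  0 < B -> 0 < b -> indep_subgaussian_rows B b M -> measurable F ->
  (forall w, F w -> 2 / b * (m + n)%:R < \sum_i enorm (rowvec i (M w)) ^+ 2) ->
  (P F <= (expR (- 1) ^+ m * (2 * (1 + B)) ^+ n)%:E)%E.
Proof.
move=> B0 b0 [indep tail] mF FM.
set y : R := expR (- 1).
have y0 : 0 <= y by exact: expR_ge0.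
have y1 : y <= 2^-1.
  rewrite /y expRN lef_pV2 ?posrE ?expR_gt0 //.
  by have := expR_ge1Dx (1 : R); lra.
have h0 : 0 < 2 / b by rewrite divr_gt0.
(* For [j = 0] this is the whole space: a row rounded to 0 is unconstrained. *)
pose S (j : 'I_m.+1) : set 'cV[R]_n :=
  [set v | (j == ord0) || (2 / b * j%:R < enorm v ^+ 2)].
have SE v (j : 'I_m.+1) : j != ord0 -> S j v = (Num.sqrt (2 / b * j%:R) < enorm v) :> Prop.
  move=> j0; have jp : 0 < (j : nat)%:R :> R by rewrite ltr0n lt0n.
  rewrite /S /= (negbTE j0) /= -[in RHS](ger0_norm (enorm_ge0 _)) -sqrtr_sqr.
  rewrite !ltNge; congr (is_true (~~ _)); rewrite ler_sqrt // mulr_ge0 // ltW //.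
have open_preimage_S : forall (V : topologicalType) (f : V -> 'cV[R]_n) (j : 'I_m.+1),
    (forall i, continuous (fun X => f X i ord0)) -> open (f @^-1` S j).
  move=> V f j fc; have [->|j0] := eqVneq j ord0.
    by rewrite (_ : _ @^-1` _ = setT); [exact: openT|apply/seteqP].
  have -> : f @^-1` S j = (fun X => enorm (f X)) @^-1` [set t | Num.sqrt (2 / b * j%:R) < t].
    by apply/funext => X; rewrite /preimage /= (SE (f X) j).
  by apply: open_comp; [move=> X _; exact: continuous_enorm|exact: open_gt].
have mS i j : measurable ((fun w => rowvec i (M w)) @^-1` S j).
  rewrite -[X in measurable X]setTI.
  apply: (measurable_funPT M _ ((@rowvec R n i) @^-1` S j)) => //.
  apply: measurable_borel; apply: open_preimage_S => l.
  rewrite [X in continuous X](_ : _ = (fun X : 'M[R]_n => X i l)); last first.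
    by apply/funext => X; rewrite !mxE.
  exact: coord_continuous.
(* The factor [1 + B] dominates both the trivial bound 1 at [j = 0] and the constant [B] of the
   tail, taken at [t ^+ 2 = 2 * j / b]. *)
have PS i j : (P ((fun w => rowvec i (M w)) @^-1` S j) <=
    ((1 + B) * y ^+ (2 * j))%:E)%E.
  have [->|j0] := eqVneq j ord0.
    rewrite muln0 expr0 mulr1; apply: (le_trans (probability_le1 _ _)) => //.
    by rewrite lee_fin; lra.
  have jp : 0 < (j : nat)%:R :> R by rewrite ltr0n lt0n.
  have -> : (fun w => rowvec i (M w)) @^-1` S j =
      [set w | Num.sqrt (2 / b * j%:R) < enorm (rowvec i (M w))].
    by apply/funext => w; exact: SE.
  apply: (le_trans (tail i _ _)); first by rewrite sqrtr_gt0 mulr_gt0.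
  rewrite lee_fin sqr_sqrtr; last by rewrite mulr_ge0 // ltW.
  have -> : expR (- b * (2 / b * (j : nat)%:R)) = y ^+ (2 * j).
    by rewrite -expRM_natr natrM; congr expR; field; rewrite gt_eqF.
  by rewrite ler_wpM2r ?exprn_ge0 //; lra.
pose E (k : {ffun 'I_n -> 'I_m.+1}) :=
  \bigcap_(i in [set` [set: 'I_n]%SET]) (fun w => rowvec i (M w)) @^-1` S (k i).
apply: (@le_trans _ _ (\sum_(k : {ffun 'I_n -> 'I_m.+1} | (m <= \sum_i k i)%N) P (E k))%E).
  apply: finite_union_bound => // [k _|w /FM].
    by apply: fin_bigcap_measurable => // i _; exact: mS.
  by move=> /(large_sum_witness h0)[k mk kS]; exists k => // i _; exact: kS.
apply: (@le_trans _ _ (\sum_(k : {ffun 'I_n -> 'I_m.+1} | (m <= \sum_i k i)%N)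
    (\prod_i ((1 + B) * y ^+ (2 * k i)))%:E)%E); last first.
  by rewrite sumEFin lee_fin weighted_count_le //; lra.
apply: lee_sum => k _; rewrite indep; last first.
  move=> i _; apply: measurable_borel.
  by apply: (open_preimage_S _ id) => l; exact: coord_continuous.
rewrite [leLHS](eq_bigl xpredT); last by move=> i; rewrite finset.in_setT.
(* Probabilities are finite, so the products can be compared factor by factor in [R]. *)
under eq_bigr => i _.
  rewrite -[P _]fineK; last exact: fin_num_measure.
  over.
rewrite prodEFin lee_fin; apply: ler_prod => i _; rewrite fine_ge0 //=.
by rewrite -lee_fin fineK ?PS // fin_num_measure.
Qed.

End Tail.

(** Exponential decay beats any power: after taking logarithms, this is [ln z <= z] at
    [z = a * n / k]. It serves only the overwhelming probability statement. *)
Lemma expRN_le_powR (R : realType) (k a : R) (n : nat) : 0 < k -> 0 < a -> (0 < n)%N ->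
  expR (- a * n%:R) <= expR (k * ln (k / a)) / n%:R `^ k.
Proof.
move=> k0 a0 n0; have n0' : 0 < n%:R :> R by rewrite ltr0n.
rewrite ler_pdivlMr ?powR_gt0 // /powR gt_eqF // -expRD ler_expR.
have -> : n%:R = a * n%:R / k * (k / a) by field; rewrite !gt_eqF.
have z0 : 0 < a * n%:R / k by rewrite divr_gt0 // mulr_gt0.
rewrite lnM ?posrE //; last exact: divr_gt0.
have lnz : ln (a * n%:R / k) <= a * n%:R / k.
  have z1 : -1 < a * n%:R / k - 1 by lra.
  by have := le_ln1Dx z1; rewrite addrC subrK; lra.
have : k * ln (a * n%:R / k) <= k * (a * n%:R / k) by rewrite ler_pM2l.
have -> : k * (a * n%:R / k) = a * n%:R by field; rewrite gt_eqF.
have -> : - a * (a * n%:R / k * (k / a)) = - (a * n%:R) by field; rewrite !gt_eqF.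
lra.
Qed.

(** * Tail of the operator norm and conclusion *)

Lemma measurable_lt_opnorm (R : realType) (d : measure_display) (T : measurableType d)
    (P : probability T R) n (M : {RV P >-> borel 'M[R]_n}) (a : R) :
  measurable [set w | a < opnorm (M w)].
Proof.
rewrite -[X in measurable X]setTI.
apply: (measurable_funPT M _ [set X | a < opnorm X]) => //.
by apply: measurable_borel; exact: open_lt_opnorm.
Qed.

Lemma opnorm_tail (R : realType) (B b : R) : 0 < B -> 0 < b ->
  exists C c : R, [/\ 0 < C, 0 < c &
    forall (n : nat), (0 < n)%N ->
    forall (d : measure_display) (T : measurableType d) (P : probability T R)
           (M : {RV P >-> borel 'M[R]_n}),
      indep_subgaussian_rows B b M ->
      forall A : R, C <= A ->
        (P [set w | (A * Num.sqrt n%:R < opnorm (M w))%R]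
          <= (C * expR (- c * A * n%:R))%:E)%E].
Proof.
move=> B0 b0; pose h := 2 / b; pose D := 1 + B.
have h0 : 0 < h by rewrite divr_gt0.
have De0 : 0 < D * expR 1 by rewrite mulr_gt0 ?expR_gt0 // /D; lra.
(* The part [h + 1] ensures [h * (q + 1) <= A ^+ 2] for [q] the floor of [A], and makes the final
   prefactor at least 1; the part [4 * (D * expR 1)] lets half of the decay in [A] absorb [2 * D] in
   [key]. *)
exists (h + 1 + 4 * (D * expR 1)), 2^-1; split; [lra|lra|].
move=> n n0 d T P M HM A CA.
have A0 : 0 <= A by lra.
pose q := Num.trunc A.
have /andP[qA Aq] := truncn_itv A0; rewrite -/q in qA Aq.
apply: (le_trans (sum_sqr_rows_tail (m := q * n) B0 b0 HM _ _)).
- exact: measurable_lt_opnorm.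
- move=> w /= /lt_opnormP[u u1 Au].
  apply: (lt_le_trans _ (enorm_mulmx_le (M w) u1)).
  have : (A * Num.sqrt n%:R) ^+ 2 < enorm (M w *m u) ^+ 2.
    by rewrite ltrXn2r ?nnegrE ?mulr_ge0 ?sqrtr_ge0 ?enorm_ge0.
  apply: le_lt_trans; rewrite exprMn sqr_sqrtr // -/h.
  rewrite natrD natrM -[X in _ + X]mul1r -mulrDl mulrA ler_wpM2r //.
  nra.
rewrite lee_fin exprM -exprMn.
have key : expR (- 1) ^+ q * (2 * D) <= expR (- (2^-1) * A).
  rewrite -expRM_natr.
  have e1 : expR (- 1 * q%:R) <= expR (1 - A).
    by rewrite ler_expR; move: Aq; rewrite -natr1; lra.
  have D0 : 0 <= 2 * D by rewrite /D; lra.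
  apply: (le_trans (ler_wpM2r D0 e1)).
  (* One factor [expR (- 2^-1 * A)] is kept; the other cancels [2 * D * expR 1], which is at most
     [A / 2], hence at most [expR (A / 2)]. *)
  have -> : 1 - A = 1 + - 2^-1 * A + - 2^-1 * A by lra.
  rewrite !expRD mulrAC ger_pMl ?expR_gt0 //.
  rewrite mulNr expRN mulrAC ler_pdivrMr ?expR_gt0 // mul1r.
  have := expR_ge1Dx (2^-1 * A); lra.
apply: (@le_trans _ _ (expR (- 2^-1 * A * n%:R))).
  rewrite expRM_natr; apply: lerXn2r => //; rewrite nnegrE ?expR_ge0 //.
  by rewrite mulr_ge0 ?exprn_ge0 ?expR_ge0 // /D; lra.
rewrite ler_peMl ?expR_ge0 //; lra.
Qed.

Theorem proposition3p2 (R : realType) (B b : R) (B_gt0 : 0 < B) (b_gt0 : 0 < b) :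
  (exists C c : R, [/\ 0 < C, 0 < c &
    forall (n : nat), (0 < n)%N ->
    forall (d : measure_display) (T : measurableType d) (P : probability T R)
           (M : {RV P >-> borel 'M[R]_n}),
      indep_subgaussian_rows B b M ->
      forall A : R, C <= A ->
        (P [set w | (A * Num.sqrt n%:R < opnorm (M w))%R]
          <= (C * expR (- c * A * n%:R))%:E)%E])
  /\
  (exists K : R, 0 < K /\
    forall k : R, 0 < k -> exists Ck : R,
    forall (n : nat), (0 < n)%N ->
    forall (d : measure_display) (T : measurableType d) (P : probability T R)
           (M : {RV P >-> borel 'M[R]_n}),
      indep_subgaussian_rows B b M ->
      ((1 - Ck / (n%:R `^ k))%:E
        <= P [set w | (opnorm (M w) <= K * Num.sqrt n%:R)%R])%E).
Proof.
have [C [c [C0 c0 tail]]] := opnorm_tail B_gt0 b_gt0.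
split; first by exists C, c.
(* With [K = C], the tail bound at [A = C] decays at rate [c * C] in [n], which fixes the constant
   for each power [k]. *)
exists C; split=> // k k0.
exists (C * expR (k * ln (k / (c * C)))) => n n0 d T P M HM.
have -> : [set w | opnorm (M w) <= C * Num.sqrt n%:R] =
    ~` [set w | C * Num.sqrt n%:R < opnorm (M w)].
  by apply/seteqP; split=> w /=; rewrite leNgt => /negP.
rewrite probability_setC; last exact: measurable_lt_opnorm.
rewrite EFinB leeB //; apply: (le_trans (tail n n0 d T P M HM C (lexx _))).
rewrite lee_fin -[leRHS]mulrA ler_pM2l // mulNr.
by apply: expRN_le_powR; rewrite ?mulr_gt0.
Qed.
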